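(* For every positive integer $n$, $$RO_n(\mathbb{Q})=\{(I_n+S)^{-1}(I_n-S)P:\ P\in\Sigma_n,\ S\in SS_n(\mathbb{Q})\text{ with } Se=0\}.$$
   Context: $I_n$ is the identity matrix of order $n$ and $e=(1,1,\dots,1)^{\rm T}$ is the all-one column vector of length $n$. $RO_n(\mathbb{Q})$ is the set of all regular orthogonal matrices of order $n$ over $\mathbb{Q}$, i.e. $n\times n$ matrices $Q$ with rational entries such that $Q^{\rm T}Q=I_n$ and $Qe=e$. $SS_n(\mathbb{Q})$ is the set of all skew-symmetric matrices ($S^{\rm T}=-S$) of order $n$ over $\mathbb{Q}$. $\Sigma_n$ is the set of all permutation matrices of order $n$. *)

(* Defs.v *)
From mathcomp Require Import all_boot all_order all_algebra.
From mathcomp Require Import boolp classical_sets.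

Set Implicit Arguments.
Unset Strict Implicit.
Unset Printing Implicit Defensive.

Import Order.TTheory GRing.Theory Num.Theory.

Local Open Scope ring_scope.
Local Open Scope classical_set_scope.

Definition ones n : 'cV[rat]_n := const_mx 1.

Definition RO n : set 'M[rat]_n :=
  [set Q | Q^T *m Q = 1%:M /\ Q *m ones n = ones n].

Definition SS n : set 'M[rat]_n := [set S | S^T = - S].

Definition Sigma n : set 'M[rat]_n := [set P | is_perm_mx P].

Arguments RO n : clear implicits.
Arguments SS n : clear implicits.
Arguments Sigma n : clear implicits.

(* [invmx] is total, with [invmx A = A] when [A] is singular. The next lemma
   shows that this junk value never occurs in [invmx (1%:M + S)] for [S] in
   [SS n], so that this term is always the genuine inverse. *)
Lemma SS_unitmx n (S : 'M[rat]_n) : SS n S -> 1%:M + S \in unitmx.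
Proof.
move=> SK; rewrite -row_free_unit -kermx_eq0; apply/eqP/row_matrixP => i.
rewrite row0; set x := row i _.
have xS0 : x + x *m S = 0.
  by rewrite -{1}(mulmx1 x) -mulmxDr -row_mul mulmx_ker row0.
have xSx : x *m S *m x^T = 0.
  have E : (x *m S *m x^T)^T = - (x *m S *m x^T).
    by rewrite !trmx_mul trmxK SK mulNmx mulmxN mulmxA.
  apply/matrixP => a b; rewrite !ord1 !mxE.
  move/matrixP/(_ 0 0): E; rewrite [LHS]mxE [RHS]mxE => /eqP.
  by rewrite -addr_eq0 -mulr2n mulrn_eq0 /= mxE => /eqP.
have xx : x *m x^T = 0.
  by move/(congr1 (fun y => y *m x^T)): xS0; rewrite mulmxDl xSx addr0 mul0mx.
clearbody x; apply/rowP => j; rewrite [RHS]mxE.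
move/matrixP/(_ 0 0): xx; rewrite !mxE => /psumr_eq0P/(_ j isT) x2.
apply/eqP; rewrite -[_ == 0]orbb -mulf_eq0; move: x2; rewrite mxE => -> //.
by move=> k _; rewrite mxE -expr2 sqr_ge0.
Qed.

(* Main.v *)
Require Import Defs.
From mathcomp Require Import all_boot all_order all_algebra.
From mathcomp Require Import fingroup perm.
From mathcomp Require Import boolp classical_sets.

Set Implicit Arguments.
Unset Strict Implicit.
Unset Printing Implicit Defensive.

Import GRing.Theory Num.Theory.

Local Open Scope ring_scope.
Local Open Scope classical_set_scope.

(** The Cayley transform [cayley A = (1 + A)^-1 (1 - A)] is an involution on the
    matrices for which [1 + A] is invertible. It exchanges orthogonal and
    skew-symmetric matrices, and exchanges the conditions [A e = e] and
    [A e = 0]. Since [1 + S] is invertible for every rational skew-symmetric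
    [S], each product [cayley S *m P] is regular orthogonal. Conversely, if [Q]
    is regular orthogonal, it is enough to find a permutation matrix [P] such
    that [1 + Q P] is invertible: then [Q = cayley (cayley (Q P)) *m P^T].

    Such a [P] is found by maximising the rank of [1 + Q P] over all
    permutations ([perm_unitmx_add1]). It works because of a rank-increasing
    step ([rank_add1_tperm]). Let [R] be regular orthogonal and [x] a nonzero
    vector with [x R = - x]. Then [x] is orthogonal to [e], so it has two
    distinct entries, at [i] and [j] say. Let [T = 1 - u u^T], with
    [u = e_i - e_j], be the transposition matrix. If [w R T = - w], then
    [w (1 + R) = (w u) u^T]; as [R] is orthogonal, [(1 + R) x^T = 0], so
    [(w u) (x u) = 0] and hence [w u = 0], since [x u != 0]. Thus the left
    kernel of [1 + R T] lies in that of [1 + R], and it misses [x]. *)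

(** * Matrices of permutations *)

Section PermMatrix.
Variables (F : pzRingType) (n : nat).

Lemma perm_mx_const (s : 'S_n) (a : F) :
  perm_mx s *m const_mx a = const_mx a :> 'cV_n.
Proof. by rewrite -row_permE; apply/matrixP => i j; rewrite !mxE. Qed.

Lemma trmx_perm_mul (s : 'S_n) : (perm_mx s)^T *m perm_mx s = 1%:M :> 'M[F]_n.
Proof. by rewrite tr_perm_mx -perm_mxM mulVg perm_mx1. Qed.

Definition swap_vec (i j : 'I_n) : 'cV[F]_n := delta_mx i 0 - delta_mx j 0.

Lemma mul_swap_vec m (A : 'M[F]_(m, n)) i j :
  A *m swap_vec i j = col i A - col j A.
Proof. by rewrite mulmxBr -!colE. Qed.

(** A transposition acts as the reflection in the hyperplane orthogonal to
    [swap_vec i j]. *)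
Lemma tperm_mx_reflection i j :
  tperm_mx i j = 1%:M - swap_vec i j *m (swap_vec i j)^T :> 'M[F]_n.
Proof.
apply/matrixP => k l; rewrite !mxE big_ord1 !mxE !eqxx !andbT.
have [->|ki] := eqVneq k i.
  rewrite tpermL; have [->|ij] := eqVneq i j; first by rewrite subrr mul0r subr0.
  by rewrite subr0 mul1r ![l == _]eq_sym opprB addrC subrK.
have [->|kj] := eqVneq k j.
  by rewrite tpermR sub0r mulN1r opprK ![l == _]eq_sym addrC subrK.
by rewrite tpermD 1?eq_sym // subr0 mul0r subr0.
Qed.

End PermMatrix.

(** * Permuting a regular orthogonal matrix away from the eigenvalue -1 *)

Section RankStep.
Variables (F : numFieldType) (n : nat).
Implicit Types R : 'M[F]_n.

Let e : 'cV[F]_n := const_mx 1.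

Lemma neq_entries_of_sum0 (x : 'rV[F]_n) :
  x != 0 -> x *m e = 0 -> exists i j, x 0 i != x 0 j.
Proof.
move=> /rV0Pn[i xi] /matrixP/(_ 0 0); rewrite !mxE => xe; exists i.
apply/existsP; apply: contraNT xi => /existsPn xc.
have {xe}: \sum_(k < n) x 0 i = 0.
  rewrite -[RHS]xe; apply: eq_bigr => k _; rewrite mxE mulr1.
  exact/eqP/negbNE/xc.
rewrite sumr_const card_ord => /eqP; rewrite mulrn_eq0 => /orP[/eqP n0|//].
by move: (ltn_ord i); rewrite {2}n0.
Qed.

(** The eigenvalue -1 of a regular orthogonal matrix loses multiplicity when two
    columns are swapped at which some eigenvector has distinct entries. *)
Lemma rank_add1_tperm R :
    R^T *m R = 1%:M -> R *m e = e -> 1%:M + R \notin unitmx ->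
  exists i j, (\rank (1%:M + R)%R < \rank (1%:M + R *m tperm_mx i j)%R)%N.
Proof.
move=> RTR Re; rewrite -row_free_unit -kermx_eq0.
move=> /rowV0Pn[x /sub_kermxP xR0 x0].
have xR : x *m R = - x.
  by apply/eqP; rewrite -addr_eq0 addrC -{1}[x]mulmx1 -mulmxDr xR0.
have Rx : (1%:M + R) *m x^T = 0.
  rewrite mulmxDl mul1mx; apply/eqP; rewrite addrC addr_eq0; apply/eqP.
  rewrite -[x in LHS]opprK -xR linearN /= mulmxN trmx_mul mulmxA.
  by rewrite (mulmx1C RTR) mul1mx.
have xe : x *m e = 0.
  apply/eqP; have : x *m e *+ 2 == 0.
    by rewrite mulr2n -{1}Re mulmxA xR mulNmx addNr.
  by rewrite -scaler_nat scaler_eq0 pnatr_eq0.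
have [i [j xij]] := neq_entries_of_sum0 x0 xe; exists i, j.
set T := tperm_mx i j; set u := swap_vec F i j.
have TT : T *m T = 1%:M by rewrite -perm_mxM tperm2 perm_mx1.
have ev (w : 'rV_n) : w *m u = (w 0 i - w 0 j)%:M.
  by rewrite mul_swap_vec; apply/matrixP => a b; rewrite !ord1 !mxE eqxx mulr1n.
(* A left kernel vector of [1 + R T] is orthogonal to [u], so [T] fixes it
   and it is also a left kernel vector of [1 + R]. *)
have kerT (w : 'rV_n) : w *m (1%:M + R *m T) = 0 ->
    w *m u = 0 /\ w *m (1%:M + R) = 0.
  move=> wRT.
  have wT : w *m T + w *m R = 0.
    rewrite -[RHS](mul0mx _ T) -wRT mulmxDr mulmx1 mulmxDl; congr (_ + _).
    by rewrite -!mulmxA TT mulmx1.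
  have wR : w *m (1%:M + R) = (w *m u) *m u^T.
    rewrite mulmxDr mulmx1; move/eqP: wT; rewrite addrC addr_eq0 => /eqP ->.
    by rewrite /T tperm_mx_reflection mulmxBr mulmx1 subKr mulmxA.
  have wu : w *m u = 0.
    have : w *m (1%:M + R) *m x^T = 0 by rewrite -mulmxA Rx mulmx0.
    rewrite wR -mulmxA -trmx_mul !ev tr_scalar_mx -scalar_mxM.
    move=> /matrixP/(_ 0 0); rewrite !mxE mulr1n => /eqP.
    rewrite mulf_eq0 [X in _ || X]subr_eq0 (negPf xij) orbF => /eqP ->.
    by rewrite raddf0.
  by rewrite wR wu mul0mx.
have : (kermx (1%:M + R *m T)%R < kermx (1%:M + R)%R)%MS.
  apply/andP; split.
    by apply/rV_subP => w /sub_kermxP/kerT[_ ?]; apply/sub_kermxP.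
  apply/negP => /rV_subP/(_ x); rewrite !sub_kermx xR0 eqxx => /(_ isT)/eqP/kerT.
  case=> + _; rewrite ev => /matrixP/(_ 0 0); rewrite !mxE mulr1n => /eqP.
  by rewrite subr_eq0 (negPf xij).
move=> /rank_ltmx; rewrite !mxrank_ker => ltk; rewrite ltnNge.
by apply/negP => ler; move: ltk; rewrite ltnNge leq_sub2l.
Qed.

(** At a permutation of maximal rank, [rank_add1_tperm] would contradict
    maximality if [1 + R P] were singular. *)
Lemma perm_unitmx_add1 R : R^T *m R = 1%:M -> R *m e = e ->
  exists s : 'S_n, 1%:M + R *m perm_mx s \in unitmx.
Proof.
move=> RTR Re.
pose rk (s : 'S_n) := \rank (1%:M + R *m perm_mx s)%R.
have [s _ smax] := @arg_maxnP _ 1%g xpredT rk isT.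
exists s; apply/negPn/negP => /rank_add1_tperm[||i [j]].
- by rewrite trmx_mul mulmxA -(mulmxA _ R^T) RTR mulmx1 trmx_perm_mul.
- by rewrite -mulmxA perm_mx_const.
- by rewrite -mulmxA -perm_mxM ltnNge => /negP; apply; apply: smax.
Qed.

End RankStep.

(** * The Cayley transform *)

Section Cayley.
Variables (F : numFieldType) (n : nat).
Implicit Types A : 'M[F]_n.

Definition cayley A : 'M[F]_n := invmx (1%:M + A) *m (1%:M - A).

Lemma mul_add1_cayley A :
  1%:M + A \in unitmx -> (1%:M + A) *m cayley A = 1%:M - A.
Proof. by move=> uA; rewrite /cayley mulKVmx. Qed.

(** [1 + A] and [1 - A] commute, so the two factors of [cayley A] do too. *)
Lemma mul_cayley_add1 A :
  1%:M + A \in unitmx -> cayley A *m (1%:M + A) = 1%:M - A.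
Proof.
move=> uA; have comA : (1%:M - A) *m (1%:M + A) = (1%:M + A) *m (1%:M - A).
  by rewrite mulmxBl mulmxBr !mulmxDl !mulmxDr !mul1mx !mulmx1.
by rewrite -mulmxA comA mulKmx.
Qed.

(** The factor 2 comes from [(1 + A) (1 + cayley A) = (1 + A) + (1 - A)]. *)
Lemma cayleyK A : 1%:M + A \in unitmx -> cayley (cayley A) = A.
Proof.
move=> uA.
have E : (1%:M + A) *m (1%:M + cayley A) = 2%:M.
  by rewrite mulmxDr mulmx1 mul_add1_cayley // addrACA subrr addr0 -raddfD.
have uC : 1%:M + cayley A \in unitmx.
  have : (1%:M + A) *m (1%:M + cayley A) \in unitmx.
    by rewrite E unitmxE det_scalar unitrX // unitfE pnatr_eq0.
  by rewrite unitmx_mul => /andP[].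
apply: (can_inj (mulKmx uC)); rewrite mul_add1_cayley //.
apply: (can_inj (mulKmx uA)); rewrite mulmxA E mulmxBr mulmx1 mul_add1_cayley //.
by rewrite opprB addrC addrA subrK mul_scalar_mx scaler_nat mulr2n.
Qed.

(** Transposing [(1 + A) C = 1 - A], with [C = cayley A], and multiplying on the
    right by [A] gives [C^T (1 + A) = A - 1 = - C (1 + A)]. *)
Lemma cayley_skew A : 1%:M + A \in unitmx -> A^T *m A = 1%:M ->
  (cayley A)^T = - cayley A.
Proof.
move=> uA AA; apply: (can_inj (mulmxK uA)).
rewrite mulNmx mul_cayley_add1 // -{1}AA -[A in _ + A]mul1mx -mulmxDl addrC.
rewrite mulmxA -{1}[1%:M]trmx1 -linearD /= -trmx_mul mul_add1_cayley //.
by rewrite linearB /= trmx1 mulmxBl mul1mx AA opprB.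
Qed.

(** Transposing [(1 + A) C = 1 - A], with [C = cayley A], gives
    [C^T (1 - A) = 1 + A]; hence [C^T C (1 + A) = C^T (1 - A) = 1 + A]. *)
Lemma cayley_orthogonal A : 1%:M + A \in unitmx -> A^T = - A ->
  (cayley A)^T *m cayley A = 1%:M.
Proof.
move=> uA AT; apply: (can_inj (mulmxK uA)).
rewrite -mulmxA mul_cayley_add1 // mul1mx -AT -{1}[1%:M]trmx1 -linearD /=.
by rewrite -trmx_mul mul_add1_cayley // linearB /= trmx1 AT opprK.
Qed.

Lemma cayley_fixed A m (v : 'M[F]_(n, m)) :
  A *m v = v -> cayley A *m v = 0.
Proof. by move=> Av; rewrite -mulmxA mulmxBl mul1mx Av subrr mulmx0. Qed.

Lemma cayley_killed A m (v : 'M[F]_(n, m)) :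
  1%:M + A \in unitmx -> A *m v = 0 -> cayley A *m v = v.
Proof.
move=> uA Av; apply: (can_inj (mulKmx uA)).
by rewrite mulmxA mul_add1_cayley // mulmxBl mulmxDl Av subr0 addr0.
Qed.

End Cayley.

Theorem corollary1 (n : nat) (hn : (0 < n)%N) :
  RO n = [set invmx (1%:M + S) *m (1%:M - S) *m P |
           P in Sigma n & S in [set S : 'M[rat]_n | SS n S /\ S *m ones n = 0]].
Proof.
apply/seteqP; split=> [Q [QQ Qe]|_ [P /is_perm_mxP[s ->] [S [SK Se] <-]]].
  have [s us] := perm_unitmx_add1 QQ Qe; set R := Q *m perm_mx s in us.
  exists (perm_mx s^-1%g); first exact: perm_mx_is_perm.
  exists (cayley R).
    split; last by apply: cayley_fixed; rewrite -mulmxA perm_mx_const.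
    apply: cayley_skew => //.
    by rewrite trmx_mul mulmxA -(mulmxA _ Q^T) QQ mulmx1 trmx_perm_mul.
  rewrite -/(cayley (cayley R)) cayleyK // /R -mulmxA -perm_mxM mulgV perm_mx1.
  exact: mulmx1.
have uS := SS_unitmx SK; rewrite -/(cayley S); split.
  rewrite trmx_mul mulmxA -(mulmxA _ (cayley S)^T) cayley_orthogonal // mulmx1.
  exact: trmx_perm_mul.
by rewrite -mulmxA perm_mx_const; apply: cayley_killed.
Qed.
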